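(* There is a randomized non-adaptive algorithm that, for any $\delta>0$ and $B\ge 1$, recovers any hidden $B$-balanced $k$-clustering of an $n$-point universe with probability at least $1-\delta$ using $O(B^2 n\log(k/\delta)\log k)$ subset queries on sets of size $O(k)$. In particular, for $\delta=1/\mathrm{poly}(k)$ and any constant $B\ge 1$, the query complexity is $O(n\log^2 k)$.
   Context: Let $U$ be a set of $n$ points with a hidden partition $U=C_1\sqcup\cdots\sqcup C_k$. For $B\ge 1$ the partition is $B$-balanced if $\frac{n}{Bk}\le |C_i|\le \frac{Bn}{k}$ for all $i\in[k]$. A subset query on $S\subseteq U$ returns $\mathsf{count}(S)=|\{i\in[k]: C_i\cap S\neq\emptyset\}|$. Non-adaptive means the (possibly random) queries are fixed before any answer is seen. *)

(* Defs.v *)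
From HB Require Import structures.
From mathcomp Require Import all_boot all_order all_algebra.
From mathcomp Require Import reals exp.

Set Implicit Arguments.
Unset Strict Implicit.
Unset Printing Implicit Defensive.

Import Order.TTheory GRing.Theory Num.Theory.
Local Open Scope ring_scope.

Section Clusterings.
Variables (R : realType) (U : finType).
Implicit Types (P : {set {set U}}) (S : {set U}).

Definition clustering (k : nat) P : Prop :=
  partition P [set: U] /\ #|P| = k.

Definition balanced (B : R) (k : nat) P : Prop :=
  forall C : {set U}, C \in P ->
    #|U|%:R / (B * k%:R) <= #|C|%:R <= B * #|U|%:R / k%:R.

Definition subset_query P S : nat := #|[set C in P | C :&: S != set0]|.

(* Non-adaptivity: [queries] sees only the random seed, and the answers are
   available to [decode] alone.  A clustering is output as an unlabelled
   partition, since subset queries do not see the names of the clusters. *)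
Record nonadaptive_alg := NonadaptiveAlg {
  seed : finType;
  seed_prob : seed -> R;
  seed_prob_ge0 : forall w, 0 <= seed_prob w;
  seed_prob_sum1 : \sum_w seed_prob w = 1;
  queries : seed -> seq {set U};
  decode : seed -> seq nat -> {set {set U}}
}.

Implicit Type A : nonadaptive_alg.

Definition output A P (w : seed A) : {set {set U}} :=
  decode w [seq subset_query P Q | Q <- queries w].

Definition success_prob A P : R :=
  \sum_(w : seed A | output P w == P) seed_prob w.

Definition queries_at_most A (q : R) : Prop :=
  forall w : seed A, (size (queries w))%:R <= q.

Definition query_sizes_at_most A (s : R) : Prop :=
  forall (w : seed A) S, S \in queries w -> #|S|%:R <= s.

End Clusterings.

(* [delta k = 1 / poly(k)], where poly(k) stands for any function of k that is
   bounded by a polynomial. *)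
Definition inverse_poly (R : realType) (delta : nat -> R) : Prop :=
  exists p : {poly R}, forall k : nat, (0 < k)%N ->
    0 < delta k /\ (delta k)^-1 <= p.[k%:R].

(* Main.v *)
(** Draw [m] independent random samples [T_1, ..., T_m], each of about
    [k / 4B] uniform points, and query [x |: T_l] for every point [x] and every
    [l].  The answer is [count T_l], plus one exactly when the cluster of [x]
    misses [T_l]; so two points of the same cluster always get equal answers,
    and two points of clusters [C] and [D] get different ones as soon as some
    [T_l] misses [C] and hits [D].  By balancedness a single sample does so
    with probability at least [1 / 8B^2], hence [m = O(B^2 log (k / delta))]
    samples separate all ordered pairs of clusters with probability at least
    [1 - delta].  The union bound runs over pairs of clusters and not over
    points, which is why [n] does not appear in the logarithm. *)
Require Import Defs.
From HB Require Import structures.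
From mathcomp Require Import all_boot all_order all_algebra.
From mathcomp Require Import ring lra.
From mathcomp Require Import boolp reals sequences exp.

Set Implicit Arguments.
Unset Strict Implicit.
Unset Printing Implicit Defensive.

Import Order.TTheory GRing.Theory Num.Theory.
Local Open Scope ring_scope.

(** * Separation of clusters by queries, decoding, and counts of separating samples *)

Section Combinatorics.
Variable U : finType.
Implicit Types (P : {set {set U}}) (C D S : {set U}).

Definition separates S C D : bool := (C :&: S == set0) && (D :&: S != set0).

Lemma setIU1_eq0 C S x :
  (C :&: (x |: S) == set0) = (x \notin C) && (C :&: S == set0).
Proof.
rewrite setIUr setU_eq0; congr (_ && _).
apply/eqP/idP => [C0|xC]; last first.
  by apply/setP=> y; rewrite !inE andbC; case: eqP => // ->; rewrite (negbTE xC).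
apply/negP=> xC; have : x \in C :&: [set x] by rewrite !inE xC eqxx.
by rewrite C0 inE.
Qed.

Lemma subset_queryU1_pblock P S x y : partition P [set: U] ->
  pblock P x = pblock P y -> subset_query P (x |: S) = subset_query P (y |: S).
Proof.
move=> /and3P[/eqP covP trivP _] Exy; congr #|pred_of_set _|; apply/setP=> C.
rewrite !inE !setIU1_eq0; case CP: (C \in P) => //=.
suff inC z : (z \in C) = (pblock P z == C) by rewrite !inC Exy.
apply/idP/eqP => [|<-]; first exact: def_pblock.
by rewrite mem_pblock covP inE.
Qed.

(** Each cluster met by [y |: S] is met by [x |: S] too: the only one that [y] could add is its own,
    which [S] hits. The cluster of [x] is met by [x |: S] alone. *)
Lemma subset_queryU1_separates P S x y : partition P [set: U] ->
  separates S (pblock P x) (pblock P y) ->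
  (subset_query P (y |: S) < subset_query P (x |: S))%N.
Proof.
move=> /and3P[/eqP covP trivP _] /andP[missx hity].
have cov z : z \in cover P by rewrite covP inE.
apply: proper_card; apply/properP; split.
  apply/subsetP=> C; rewrite !inE => /andP[CP]; rewrite CP /=.
  rewrite !setIU1_eq0 !negb_and !negbK => /orP[yC|->]; last by rewrite orbT.
  by rewrite -(def_pblock trivP CP yC) hity orbT.
exists (pblock P x); rewrite !inE pblock_mem //= setIU1_eq0 ?mem_pblock ?cov //.
rewrite missx andbT negbK; apply/negP => yx.
by move: hity; rewrite (same_pblock trivP yx) missx.
Qed.

Section Decoder.
Variables (m : nat) (T : 'I_m -> {set U}).

Definition point_queries : seq {set U} :=
  [seq x |: T l | l <- enum 'I_m, x <- enum U].

(* Equal sets may be queried several times; the first occurrence is read, which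
   is harmless as the answer only depends on the set. *)
Definition answer_to (ans : seq nat) S : nat :=
  nth 0%N ans (index S point_queries).

Definition point_decode (ans : seq nat) : {set {set U}} :=
  preim_partition (fun x => [ffun l => answer_to ans (x |: T l)]) [set: U].

Lemma size_point_queries : size point_queries = (m * #|U|)%N.
Proof. by rewrite size_allpairs size_enum_ord -cardE. Qed.

Lemma mem_point_queries l x : x |: T l \in point_queries.
Proof. by apply: (@allpairs_f _ _ _ (fun l x => x |: T l)); rewrite mem_enum. Qed.

Lemma answer_toE P S : S \in point_queries ->
  answer_to [seq subset_query P Q | Q <- point_queries] S = subset_query P S.
Proof. by move=> SQ; rewrite /answer_to (nth_map set0) ?index_mem // nth_index. Qed.

(** Both sides are partitions into fibres, of the answer vector and of [pblock P]. The fibres agree: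
    answers are constant on a cluster, and a separating [T l] tells two clusters apart. *)
Lemma point_decodeK P : partition P [set: U] ->
  (forall C D, C \in P -> D \in P -> C != D -> exists l, separates (T l) C D) ->
  point_decode [seq subset_query P Q | Q <- point_queries] = P.
Proof.
move=> partP sepP; rewrite -[RHS](preim_partition_pblock partP).
have /and3P[/eqP covP trivP _] := partP.
have cov z : z \in cover P by rewrite covP inE.
apply: eq_imset => x; apply/setP => y; rewrite !inE /=.
apply/eqP/eqP => [/ffunP Exy|Exy].
  apply/eqP; apply/negPn/negP => nxy.
  have [l sep] := sepP _ _ (pblock_mem (cov x)) (pblock_mem (cov y)) nxy.
  have := Exy l; rewrite !ffunE !answer_toE ?mem_point_queries // => E.
  by have := subset_queryU1_separates partP sep; rewrite E ltnn.
apply/ffunP=> l; rewrite !ffunE !answer_toE ?mem_point_queries //.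
exact: subset_queryU1_pblock.
Qed.

End Decoder.

(** Sampling is with replacement: a uniform sample is a uniform function, and probabilities become
    counts of functions. *)
Definition sample_set (s : nat) (t : {ffun 'I_s -> U}) : {set U} :=
  [set t i | i : 'I_s].

Lemma card_sample_set s (t : {ffun 'I_s -> U}) : (#|sample_set t| <= s)%N.
Proof. by apply: leq_trans (leq_imset_card _ _) _; rewrite card_ord. Qed.

Lemma sample_set_missE s (t : {ffun 'I_s -> U}) C :
  (C :&: sample_set t == set0) = (t \in ffun_on (mem (~: C))).
Proof.
rewrite setI_eq0; apply/idP/ffun_onP => [dis i|avoid].
  rewrite /= inE; apply: contraTN dis => tC.
  by apply/pred0Pn; exists (t i); rewrite /= tC imset_f.
apply/pred0P=> x /=; apply/negP => /andP[xC /imsetP[i _ Ex]].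
by have := avoid i; rewrite /= inE -Ex xC.
Qed.

(** Samples missing [C], minus those missing [C :|: D], which are among them; to miss a set is to
    take values in its complement. *)
Lemma card_separating_samples s C D : [disjoint C & D] ->
  (#|[set t : {ffun 'I_s -> U} | separates (sample_set t) C D]|
    = (#|U| - #|C|) ^ s - (#|U| - (#|C| + #|D|)) ^ s)%N.
Proof.
move=> disCD; pose miss E := [set t : {ffun 'I_s -> U} | E :&: sample_set t == set0].
have card_miss E : #|miss E| = ((#|U| - #|E|) ^ s)%N.
  rewrite -[in RHS](setCK E) -cardsCs -[X in (_ ^ X)%N](card_ord s) -card_ffun_on.
  by apply: eq_card => t; rewrite inE sample_set_missE.
have -> : [set t : {ffun 'I_s -> U} | separates (sample_set t) C D]
    = miss C :\: miss (C :|: D).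
  apply/setP => t; rewrite !inE setIUl setU_eq0 negb_and /separates.
  by case: (C :&: _ == set0); rewrite /= ?andbT ?andbF.
rewrite cardsD !card_miss; congr (_ - _)%N.
rewrite (setIidPr _) ?card_miss.
  by rewrite cardsU (disjoint_setI0 disCD) cards0 subn0.
by apply/subsetP=> t; rewrite !inE setIUl setU_eq0 => /andP[].
Qed.

End Combinatorics.

(** * Probability that one sample separates two clusters, and counting bounds *)

Section Estimates.
Variable R : realType.

Lemma bernoulli_ineq (a : R) n : 0 <= a <= 1 -> 1 - n%:R * a <= (1 - a) ^+ n.
Proof.
move=> /andP[a0 a1]; elim: n => [|n IHn]; first by rewrite mul0r subr0 expr0.
rewrite exprS; apply: le_trans (ler_wpM2l _ IHn); last by lra.
have : 0 <= n%:R * a * a by rewrite !mulr_ge0.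
by rewrite -natr1; nra.
Qed.

(** Each of the [n] terms in the cofactor of [x - y] in [x ^+ n - y ^+ n] is at least
    [y ^+ n.-1]. *)
Lemma subrXX_ge (x y : R) n : 0 <= y <= x ->
  (x - y) * (n%:R * y ^+ n.-1) <= x ^+ n - y ^+ n.
Proof.
move=> /andP[y0 yx]; rewrite subrXX ler_wpM2l ?subr_ge0 //.
have -> : n%:R * y ^+ n.-1 = \sum_(i < n) y ^+ n.-1.
  by rewrite sumr_const card_ord mulr_natl.
apply: ler_sum => i _.
have i_le : (i <= n.-1)%N by rewrite -ltnS (ltn_predK (ltn_ord i)).
have -> : y ^+ n.-1 = y ^+ (n.-1 - i) * y ^+ i by rewrite -exprD subnK.
by rewrite ler_wpM2r ?exprn_ge0 // lerXn2r ?nnegrE // (le_trans y0).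
Qed.

Lemma nat_ceil (x : R) : 0 <= x -> exists n : nat, x <= n%:R <= x + 1.
Proof.
move=> x0; exists (Num.truncn x).+1.
have /andP[lex /ltW ->] := truncn_itv x0.
by rewrite -natr1 lerD2r.
Qed.

Variable U : finType.
Implicit Types (P : {set {set U}}) (C D S : {set U}).

(** With [p], [q] the densities of [C], [D], the fraction is [(1 - p)^s - (1 - p - q)^s], which is
    at least [q s (1 - p - q)^(s-1)]. These three factors are at least [1/(Bk)], [k/(4B)] and
    [1/2]. *)
Lemma separating_fraction (B : R) k s P C D : (0 < k)%N -> 1 <= B ->
  k%:R / (4 * B) <= s%:R <= k%:R / (4 * B) + 1 ->
  clustering k P -> balanced B k P -> C \in P -> D \in P -> C != D ->
  (8 * B ^+ 2)^-1 * #|{ffun 'I_s -> U}|%:R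
    <= #|[set t : {ffun 'I_s -> U} | separates (sample_set t) C D]|%:R.
Proof.
move=> k0 B1 /andP[s_ge s_le] [/and3P[_ /trivIsetP trivP P0] _] balP CP DP CD.
have disCD := trivP _ _ CP DP CD.
have kR : 0 < k%:R :> R by rewrite ltr0n.
have B0 : 0 < B by lra.
have s0 : (0 < s)%N by rewrite -(ltr0n R) (lt_le_trans _ s_ge) // divr_gt0 //; lra.
have cardCD : (#|C| + #|D| <= #|U|)%N.
  by have := max_card (mem (C :|: D)); rewrite cardsU (disjoint_setI0 disCD) cards0 subn0.
have C0 : (0 < #|C|)%N.
  by rewrite card_gt0; apply: contraNneq P0 => <-.
have n0 : (0 < #|U|)%N by apply: leq_trans cardCD; rewrite addn_gt0 C0.
rewrite card_separating_samples // card_ffun card_ord.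
have nR : 0 < #|U|%:R :> R by rewrite ltr0n.
set n : R := #|U|%:R in nR.
have [p Ep] : exists p, #|C|%:R = p * n by exists (#|C|%:R / n); rewrite divfK ?gt_eqF.
have [q Eq] : exists q, #|D|%:R = q * n by exists (#|D|%:R / n); rewrite divfK ?gt_eqF.
have p0 : 0 <= p by rewrite -(pmulr_lge0 _ nR) -Ep.
have q0 : 0 <= q by rewrite -(pmulr_lge0 _ nR) -Eq.
have pq1 : p + q <= 1.
  by rewrite -(ler_pM2r nR) mulrDl -Ep -Eq mul1r -natrD ler_nat.
rewrite natrB; last by rewrite leq_exp2r // leq_sub2l // leq_addr.
rewrite !natrX !natrB ?natrD ?Ep ?Eq //; last first.
  by rewrite (leq_trans _ cardCD) // leq_addr.
rewrite -/n.
have -> : n - p * n = (1 - p) * n by ring.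
have -> : n - (p * n + q * n) = (1 - (p + q)) * n by ring.
rewrite !exprMn -mulrBl ler_wpM2r ?exprn_ge0 ?(ltW nR) //.
have q_ge : (B * k%:R)^-1 <= q.
  have /andP[+ _] := balP D DP; rewrite Eq -/n mulrC.
  by rewrite ler_pM2r.
have pB E e : E \in P -> #|E|%:R = e * n -> e <= B / k%:R.
  move=> EP Ee; have /andP[_] := balP E EP; rewrite Ee -/n mulrAC.
  by rewrite ler_pM2r.
have p_le := pB _ _ CP Ep; have q_le := pB _ _ DP Eq.
have /(subrXX_ge s) : 0 <= 1 - (p + q) <= 1 - p by apply/andP; split; lra.
apply: le_trans; have -> : 1 - p - (1 - (p + q)) = q by ring.
(* Rounding [s] up is harmless, as the exponent [s.-1] is at most [k/(4B)]; since [p + q <= 2B/k],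
   Bernoulli's inequality subtracts at most [1/2]. *)
have half : 2^-1 <= (1 - (p + q)) ^+ s.-1.
  apply: le_trans (bernoulli_ineq s.-1 _); last by apply/andP; split; lra.
  have s1 : s.-1%:R <= k%:R / (4 * B) by move: s_le; rewrite -(prednK s0) -natr1; lra.
  have : s.-1%:R * (p + q) <= k%:R / (4 * B) * (2 * (B / k%:R)).
    by rewrite ler_pM //; lra.
  have -> : k%:R / (4 * B) * (2 * (B / k%:R)) = 2^-1 :> R.
    by field; rewrite !gt_eqF.
  by lra.
have -> : (8 * B ^+ 2)^-1 = (B * k%:R)^-1 * (k%:R / (4 * B) * 2^-1).
  by field; rewrite !gt_eqF.
have kB0 : 0 <= k%:R / (4 * B) by rewrite divr_ge0 //; lra.
rewrite ler_pM ?mulr_ge0 ?invr_ge0 ?mulr_ge0 //; try lra.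
by rewrite ler_pM //; lra.
Qed.

Lemma card_bigcup_le (I W : finType) (A : {pred I}) (F : I -> {set W}) :
  (#|\bigcup_(i in A) F i| <= \sum_(i in A) #|F i|)%N.
Proof.
elim/big_rec2: _ => [|i n S _ le_n]; first by rewrite cards0.
by apply: leq_trans (leq_card_setU _ _) _; rewrite leq_add2l.
Qed.

Lemma card_avoiding_samples m s (G : {set {ffun 'I_s -> U}}) :
  #|[set w : {ffun 'I_m -> {ffun 'I_s -> U}} | ~~ [exists l, w l \in G]]|
    = ((#|{ffun 'I_s -> U}| - #|G|) ^ m)%N.
Proof.
rewrite -[in RHS](setCK G) -cardsCs -[X in (_ ^ X)%N](card_ord m) -card_ffun_on.
apply: eq_card => w; rewrite inE negb_exists.
by apply: eq_forallb => l; rewrite !inE.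
Qed.

End Estimates.

(** * Algorithms with uniform seeds, and the sampling algorithm *)

Section Algorithms.
Variables (R : realType) (U : finType).
Implicit Types P : {set {set U}}.

(** Success is bounded through any set [bad] containing the failing seeds, so that a union bound
    becomes a bound on a cardinality. *)
Lemma exists_uniform_alg (W : finType) (q : W -> seq {set U})
    (d : W -> seq nat -> {set {set U}}) : (0 < #|W|)%N ->
  exists A : nonadaptive_alg R U,
    [/\ forall P (bad : {set W}),
          (forall w, w \notin bad -> d w [seq subset_query P Q | Q <- q w] = P) ->
          1 - #|bad|%:R / #|W|%:R <= success_prob A P,
        forall x, (forall w, (size (q w))%:R <= x) -> queries_at_most A x &
        forall x, (forall w S, S \in q w -> #|S|%:R <= x) -> query_sizes_at_most A x].
Proof.
move=> W0; have WR : 0 < #|W|%:R :> R by rewrite ltr0n.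
have p0 (w : W) : 0 <= #|W|%:R^-1 :> R by rewrite invr_ge0 ltW.
have p1 : \sum_(w : W) #|W|%:R^-1 = 1 :> R.
  by rewrite sumr_const -[LHS]mulr_natl divff ?gt_eqF.
exists (NonadaptiveAlg p0 p1 q d); split=> // P bad badP.
rewrite /success_prob /output /= lerBlDr -[leLHS]p1.
rewrite (bigID (fun w => d w [seq subset_query P Q | Q <- q w] == P)) /= lerD2l.
apply: (@le_trans _ _ (\sum_(w in bad) #|W|%:R^-1)).
  rewrite [leRHS]big_mkcond [leLHS]big_mkcond; apply: ler_sum => w _.
  case: ifPn => [nP|_]; last by case: ifP => // _; apply: p0.
  by rewrite ifT //; apply: contraNT nP => /badP/eqP.
by rewrite sumr_const -[leLHS]mulr_natl.
Qed.

(** For degenerate parameters: at [k = 1] the factor [ln k] vanishes and no query is allowed, so a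
    constant output must do. *)
Lemma exists_trivial_alg (Q : {set {set U}}) : exists A : nonadaptive_alg R U,
  [/\ success_prob A Q = 1, forall P, 0 <= success_prob A P,
      queries_at_most A 0 & forall x, query_sizes_at_most A x].
Proof.
have p0 (w : unit) : 0 <= 1 :> R by [].
have p1 : \sum_(w : unit) 1 = 1 :> R by rewrite sumr_const card_unit.
exists (NonadaptiveAlg p0 p1 (fun=> [::]) (fun _ _ => Q)); split=> //.
  by rewrite /success_prob /output /= eqxx.
by move=> P; apply: sumr_ge0.
Qed.

(** Union bound over at most [k^2] ordered pairs of clusters: all [m] samples fail a given pair with
    probability at most [(1 - 1/(8B^2))^m <= exp(-m/(8B^2)) <= (delta/k)^2]. *)
Lemma exists_sampling_alg k (delta B : R) : (1 < k)%N -> 0 < delta < 1 ->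
    1 <= B -> (0 < #|U|)%N ->
  exists A : nonadaptive_alg R U,
    [/\ forall P, clustering k P -> balanced B k P -> 1 - delta <= success_prob A P,
        queries_at_most A
          ((16 * B ^+ 2 * ln (k%:R / delta) + 1) * #|U|%:R) &
        query_sizes_at_most A (3 * k%:R)].
Proof.
move=> k1 /andP[d0 d1] B1 U0.
have k0 : (0 < k)%N by apply: ltnW.
have kR : 1 <= k%:R :> R by rewrite ler1n.
have B2 : 1 <= B ^+ 2 by rewrite exprn_ege1.
have kd1 : 1 <= k%:R / delta by rewrite ler_pdivlMr // mul1r; lra.
have L0 := ln_ge0 kd1.
set L := ln _ in L0 *.
have s_ge0 : 0 <= k%:R / (4 * B) by rewrite divr_ge0 //; lra.
have [s s_itv] := nat_ceil s_ge0.
(* The constant [16] is twice [8], so that [m/(8B^2) >= 2L]; the factor [2] pays for the pairs being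
   up to [k^2] in number. *)
have [m /andP[m_ge m_le]] : exists m : nat, 16 * B ^+ 2 * L <= m%:R <= 16 * B ^+ 2 * L + 1.
  by apply: nat_ceil; rewrite mulr_ge0 //; lra.
pose W : finType := {ffun 'I_m -> {ffun 'I_s -> U}}.
pose T (w : W) l := sample_set (w l).
have N0 : (0 < #|{ffun 'I_s -> U}|)%N by rewrite card_ffun expn_gt0 U0.
have W0 : (0 < #|W|)%N by rewrite card_ffun expn_gt0 N0.
have [A [succA szA cardA]] :=
  exists_uniform_alg (fun w => point_queries (T w)) (fun w => point_decode (T w)) W0.
exists A; split; last 1 first.
- apply: cardA => w S /allpairsP[[l x] [_ _ ->]] /=.
  have /andP[_ s_le] := s_itv.
  (* The size is at most [1 + s <= k/(4B) + 2 <= 3k]. *)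
  have : #|x |: T w l|%:R <= 1 + s%:R :> R.
    rewrite nat1r ler_nat; apply: leq_trans (leq_card_setU _ _) _.
    by rewrite cards1 add1n ltnS card_sample_set.
  have : k%:R / (4 * B) <= k%:R by rewrite ler_pdivrMr ?ler_peMr //; lra.
  by lra.
- move=> P clP balP.
  have [partP cardP] := clP.
  pose G (CD : {set U} * {set U}) : {set {ffun 'I_s -> U}} :=
    [set t | separates (sample_set t) CD.1 CD.2].
  pose F CD : {set W} := [set w : W | ~~ [exists l, w l \in G CD]].
  pose I := [set CD in setX P P | CD.1 != CD.2].
  pose bad := \bigcup_(CD in I) F CD.
  apply: le_trans (succA P bad _); last first.
    move=> w wbad; apply: point_decodeK => // C D CP DP CD.
    have /existsP[l] : [exists l, w l \in G (C, D)].
      apply: contraNT wbad => nsep; apply/bigcupP; exists (C, D); rewrite !inE //=.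
      by rewrite CP DP.
    by rewrite inE; exists l.
  rewrite lerD2l lerN2 ler_pdivrMr ?ltr0n //.
  have cardF CD : CD \in I -> #|F CD|%:R <= expR (- (2 * L)) * #|W|%:R :> R.
    rewrite !inE => /andP[/andP[CP DP] CD'].
    rewrite card_avoiding_samples natrX natrB ?max_card //.
    have frac := separating_fraction k0 B1 s_itv clP balP CP DP CD'.
    rewrite -/(G CD) in frac; rewrite [in leRHS]card_ffun card_ord natrX.
    set N : R := (#|{ffun _ -> U}|)%:R in frac *.
    apply: (@le_trans _ _ ((expR (- (8 * B ^+ 2)^-1) * N) ^+ m)).
      rewrite lerXn2r ?nnegrE ?subr_ge0 ?ler_nat ?max_card //.
        by rewrite mulr_ge0 ?expR_ge0.
      apply: (@le_trans _ _ ((1 - (8 * B ^+ 2)^-1) * N)); first by lra.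
      by rewrite ler_wpM2r // expR_ge1Dx.
    rewrite exprMn ler_wpM2r ?exprn_ge0 // -expRM_natl ler_expR.
    rewrite mulrN lerN2 ler_pdivlMr; last by lra.
    by apply: le_trans m_ge; lra.
  have expL : expR (- (2 * L)) = (delta / k%:R) ^+ 2.
    rewrite -mulrN expRM_natl expRN lnK ?posrE ?(lt_le_trans _ kd1) //.
    by rewrite invf_div.
  apply: (@le_trans _ _ (\sum_(CD in I) expR (- (2 * L)) * #|W|%:R)).
    apply: (@le_trans _ _ (\sum_(CD in I) #|F CD|)%N%:R).
      by rewrite ler_nat card_bigcup_le.
    by rewrite natr_sum ler_sum.
  rewrite sumr_const -[leLHS]mulr_natl mulrA ler_wpM2r // expL.
  have : #|I|%:R <= k%:R ^+ 2 :> R.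
    rewrite -natrX ler_nat -cardP -mulnn -cardsX; apply: subset_leq_card.
    by apply/subsetP => CD; rewrite inE => /andP[].
  move=> /(ler_wpM2r (sqr_ge0 (delta / k%:R))) /le_trans; apply.
  rewrite -exprMn mulrC divfK ?gt_eqF ?(lt_le_trans _ kR) //.
  (* The total failure [delta^2] is at most [delta] because [delta < 1]. *)
  by rewrite expr2 ler_piMr //; lra.
- by apply: szA => w; rewrite size_point_queries natrM ler_wpM2r.
Qed.

End Algorithms.

(** * Degenerate parameters, explicit constants and inverse polynomial error *)

Section QueryBounds.
Variable R : realType.

(* [16 + 1 / ln 2] absorbs the rounding of [m], as [ln (k / delta) >= ln 2]; the
   quotient by [ln 2] pays for the factor [ln k], which the sampling algorithm does
   not need; and [3] is for the query sizes. *)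
Definition query_constant : R := (16 + (ln 2)^-1) / ln 2 + 3.

Lemma ln2_gt0 : 0 < ln 2 :> R.
Proof. by rewrite ln_gt0 // ltr1n. Qed.

Lemma query_constant_ge3 : 3 <= query_constant.
Proof.
have l2 := ln2_gt0.
by rewrite lerDr divr_ge0 ?addr_ge0 ?invr_ge0 ?ltW.
Qed.

Lemma ln2_le_ln_nat k : (1 < k)%N -> ln 2 <= ln k%:R :> R.
Proof. by move=> k1; rewrite ler_ln ?posrE ?ltr0n ?ler_nat // ltnW. Qed.

(** [A] comes before the hypotheses so that choice yields a total function of the parameters. The
    last clause serves the inverse polynomial case, where a huge [delta] would make the absolute
    logarithm huge. *)
Lemma exists_clustering_alg (U : finType) k (delta B : R) :
  exists A : nonadaptive_alg R U, (0 < k)%N -> 0 < delta -> 1 <= B ->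
    [/\ forall P, clustering k P -> balanced B k P -> 1 - delta <= success_prob A P,
        queries_at_most A
          (query_constant * (B ^+ 2 * #|U|%:R * `|ln (k%:R / delta)| * ln k%:R)),
        query_sizes_at_most A (query_constant * k%:R) &
        1 <= delta -> queries_at_most A 0].
Proof.
have [A0 [succ1 succ0 q0 s0]] := @exists_trivial_alg R U [set [set: U]].
have c3 := query_constant_ge3; have c0 : 0 <= query_constant by lra.
have q0W k' : (0 < k')%N -> queries_at_most A0
    (query_constant * (B ^+ 2 * #|U|%:R * `|ln (k'%:R / delta)| * ln k'%:R)).
  move=> k0 w; apply: le_trans (q0 w) _.
  by rewrite !(sqr_ge0, mulr_ge0) ?ln_ge0 ?ler1n.
have [d1|d1] := leP 1 delta.
  exists A0 => k0 d0 B1; split => // [P _ _|]; last exact: q0W.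
  by apply: le_trans (succ0 P); lra.
(* A single cluster is the whole universe, which the trivial algorithm outputs. *)
have [k1|k1] := leqP k 1.
  exists A0 => k0 d0 B1; split => // [P [partP cardP] _|]; last exact: q0W.
  have /eqP/cards1P[C EP] : #|P| = 1%N by apply/eqP; rewrite cardP eqn_leq k1.
  have /and3P[/eqP covP _ _] := partP.
  have -> : P = [set [set: U]] by rewrite -covP EP /cover big_set1.
  by rewrite succ1; lra.
(* Blocks are nonempty, so an empty universe has no clustering into [k > 1] clusters. *)
have [U0|U0] := posnP #|U|.
  exists A0 => k0 d0 B1; split => // [P [partP cardP] _|]; last exact: q0W.
  have /and3P[_ _ /negP[]] := partP.
  have [C CP] : exists C, C \in P by apply/set0Pn; rewrite -card_gt0 cardP.
  suff <- : C = set0 by [].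
  by apply/eqP; rewrite -cards_eq0 -leqn0 -U0 max_card.
have [d0|d0] := ltP 0 delta; last by exists A0.
have [B1|B1] := leP 1 B; last by exists A0.
have d01 : 0 < delta < 1 by rewrite d0.
have [A [succA qA sA]] := exists_sampling_alg k1 d01 B1 U0.
have kR : 1 < k%:R :> R by rewrite ltr1n.
exists A => k0 _ _; split=> //.
- move=> w; apply: le_trans (qA w) _.
  have l2 := ln2_gt0; have lk := ln2_le_ln_nat k1.
  have L_ge : ln k%:R <= ln (k%:R / delta).
    by rewrite ler_ln ?posrE ?divr_gt0 ?ler_pdivlMr ?ler_piMr //; lra.
  rewrite [`|_|]ger0_norm; last by lra.
  set L := ln (_ / _) in L_ge *.
  have B2 : 1 <= B ^+ 2 by rewrite exprn_ege1.
  have step1 : 16 * B ^+ 2 * L + 1 <= (16 + (ln 2)^-1) * (B ^+ 2 * L).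
    have : 1 <= (ln 2)^-1 * (B ^+ 2 * L).
      rewrite ler_pdivlMl // mulr1; apply: le_trans (le_trans lk L_ge) _.
      by rewrite ler_peMl //; lra.
    by lra.
  have a0 : 0 <= 16 + (ln 2)^-1 :> R by rewrite addr_ge0 ?invr_ge0 ?ltW.
  have BL0 : 0 <= B ^+ 2 * L by rewrite mulr_ge0 //; lra.
  have step2 : (16 + (ln 2)^-1) * (B ^+ 2 * L)
      <= query_constant * (B ^+ 2 * L * ln k%:R).
    apply: (@le_trans _ _ ((16 + (ln 2)^-1) / ln 2 * (B ^+ 2 * L * ln k%:R))); last first.
      by rewrite ler_wpM2r ?mulr_ge0 ?lerDl //; lra.
    by rewrite -mulrA ler_wpM2l // ler_pdivlMl // mulrC ler_wpM2l.
  have -> : query_constant * (B ^+ 2 * #|U|%:R * L * ln k%:R)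
      = query_constant * (B ^+ 2 * L * ln k%:R) * #|U|%:R by ring.
  by rewrite ler_wpM2r // (le_trans step1).
- move=> w S Sw; apply: le_trans (sA w S Sw) _.
  by rewrite ler_wpM2r.
Qed.

(** [M] is the sum of the absolute values of the coefficients, plus one to make [ln M]
    nonnegative. *)
Lemma horner_le_monomial (p : {poly R}) : exists2 M : R, 1 <= M &
  forall x, 1 <= x -> p.[x] <= M * x ^+ size p.
Proof.
exists (1 + \sum_(i < size p) `|p`_i|) => [|x x1]; first by rewrite lerDl sumr_ge0.
have x0 : 0 <= x by lra.
rewrite horner_coef mulrDl mul1r ler_wpDl ?exprn_ge0 // mulr_suml.
apply: ler_sum => i _; apply: (@le_trans _ _ (`|p`_i| * x ^+ i)).
  by rewrite ler_wpM2r ?exprn_ge0 ?ler_norm.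
by rewrite ler_wpM2l // ler_weXn2l // ltnW.
Qed.

(** The logarithm of [1 / delta k] is at most [ln M + size p * ln k], and [ln M] is absorbed into a
    multiple of [ln k] because [ln k >= ln 2]. *)
Lemma ln_inverse_poly (delta : nat -> R) : inverse_poly delta ->
  exists2 K : R, 0 <= K & forall k, (1 < k)%N -> delta k < 1 ->
    `|ln (k%:R / delta k)| <= K * ln k%:R.
Proof.
move=> [p pP]; have [M M1 Mp] := horner_le_monomial p.
have l2 := ln2_gt0; have M0 := ln_ge0 M1.
exists (1 + (size p)%:R + ln M / ln 2) => [|k k1 d1].
  by rewrite !addr_ge0 ?divr_ge0 ?(ltW l2).
have [d0 dp] := pP k (ltnW k1).
have kR : 1 < k%:R :> R by rewrite ltr1n.
have lk := ln2_le_ln_nat k1.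
have kd1 : 1 <= k%:R / delta k by rewrite ler_pdivlMr // mul1r; lra.
rewrite ger0_norm ?ln_ge0 // lnM ?posrE ?invr_gt0 //; last by lra.
have : ln (delta k)^-1 <= ln (M * k%:R ^+ size p).
  rewrite ler_ln ?posrE ?invr_gt0 ?mulr_gt0 ?exprn_gt0 //; try lra.
  by apply: le_trans dp (Mp _ _); lra.
rewrite lnM ?posrE ?exprn_gt0 ?lnXn //; try lra.
rewrite -[ln _ *+ _]mulr_natl.
have : ln M <= ln M / ln 2 * ln k%:R.
  by rewrite mulrAC ler_pdivlMr // ler_wpM2l.
by rewrite !mulrDl mul1r; lra.
Qed.

End QueryBounds.

Theorem theorem4p4 (R : realType) :
  exists alg : forall U : finType, nat -> R -> R -> nonadaptive_alg R U,
    (exists c : R, forall (U : finType) (k : nat) (delta B : R),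
       (0 < k)%N -> 0 < delta -> 1 <= B ->
       [/\ forall P : {set {set U}}, clustering k P -> balanced B k P ->
             1 - delta <= success_prob (alg U k delta B) P,
           queries_at_most (alg U k delta B)
             (c * (B ^+ 2 * #|U|%:R * `|ln (k%:R / delta)| * ln k%:R)) &
           query_sizes_at_most (alg U k delta B) (c * k%:R)])
    /\
    (forall (B : R) (delta : nat -> R), 1 <= B -> inverse_poly delta ->
       exists c : R, forall (U : finType) (k : nat), (0 < k)%N ->
         queries_at_most (alg U k (delta k) B)
           (c * (#|U|%:R * ln k%:R ^+ 2))).
Proof.
pose alg U k delta B := projT1 (cid (@exists_clustering_alg R U k delta B)).
have algP U k delta B := projT2 (cid (@exists_clustering_alg R U k delta B)).
exists alg; split.
  exists (query_constant R) => U k delta B k0 d0 B1.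
  by have [] := algP U k delta B k0 d0 B1.
move=> B delta B1 polyd; have [K K0 lnK] := ln_inverse_poly polyd.
have [p pP] := polyd.
have c0 : 0 <= query_constant R by have := query_constant_ge3 R; lra.
exists (query_constant R * B ^+ 2 * K) => U k k0 w.
have [d0 _] := pP k k0; have [_ qle _ q0] := algP U k (delta k) B k0 d0 B1.
have lk0 : 0 <= ln k%:R :> R by rewrite ln_ge0 ?ler1n.
(* For [delta k >= 1] the absolute logarithm may exceed any fixed multiple of [ln k]; making no
   query settles this case. *)
have [d1|d1] := leP 1 (delta k).
  by apply: le_trans (q0 d1 w) _; rewrite !(sqr_ge0, mulr_ge0).
apply: le_trans (qle w) _.
(* [lnK] requires [k >= 2]; at [k = 1] both bounds are [0]. *)
have [k1|k1] := leqP k 1.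
  have -> : k = 1%N by apply/eqP; rewrite eqn_leq k1.
  by rewrite ln1 expr0n /= !mulr0.
have -> : query_constant R * B ^+ 2 * K * (#|U|%:R * ln k%:R ^+ 2)
    = query_constant R * (B ^+ 2 * #|U|%:R * (K * ln k%:R) * ln k%:R) by ring.
rewrite ler_wpM2l // ler_wpM2r // ler_wpM2l ?lnK //.
by rewrite mulr_ge0 ?sqr_ge0.
Qed.
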